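(* Let $d\in\mathbb N$. A sequence $(G_n)$ of finite graphs with maximum degree at most $d$ such that $\lim_{n\to\infty}|G_n|=\infty$ is FO-convergent if and only if it is both BS-convergent and elementarily convergent.
   Context: $\langle\phi,G\rangle=|\{(v_1,\dots,v_p)\in V(G)^p:G\models\phi(v_1,\dots,v_p)\}|/|G|^p$ for a first-order formula $\phi$ with free variables among $x_1,\dots,x_p$; $(G_n)$ is FO-convergent if $\langle\phi,G_n\rangle$ converges for every first-order $\phi$, and elementarily convergent if for every first-order sentence $\theta$, either $G_n\models\theta$ for all sufficiently large $n$ or $G_n\not\models\theta$ for all sufficiently large $n$. $(G_n)$ is BS-convergent if for every integer $r$ and every finite rooted connected graph $(F,o)$ with maximum degree at most $d$, $\lim_{n\to\infty}|\{v:(B_{G_n}(v,r),v)\cong(F,o)\}|/|G_n|$ exists, where $B_G(v,r)$ is the subgraph induced by the vertices at distance at most $r$ from $v$. *)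

(* Defs.v *)
From Stdlib Require Import Reals.
From mathcomp Require Import all_boot.

Set Implicit Arguments.
Unset Strict Implicit.
Unset Printing Implicit Defensive.

Record graph := Graph {
  vert :> finType;
  adj : rel vert;
  adj_sym : symmetric adj;
  adj_irr : irreflexive adj }.

Definition gorder (G : graph) : nat := #|vert G|.

Definition maxdeg_le (d : nat) (G : graph) : Prop :=
  forall x : vert G, #|[set y | adj x y]| <= d.

Definition connectedb (G : graph) : Prop :=
  forall x y : vert G, connect (@adj G) x y.

(* variables x_1, x_2, ... are represented by 0, 1, ... *)
Inductive form :=
| FEq of nat & nat
| FAdj of nat & nat
| FNot of form
| FAnd of form & form
| FOr of form & form
| FExists of nat & form
| FForall of nat & form.

Fixpoint fv (phi : form) : seq nat :=
  match phi with
  | FEq i j | FAdj i j => [:: i; j]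
  | FNot f => fv f
  | FAnd f g | FOr f g => fv f ++ fv g
  | FExists i f | FForall i f => filter (predC1 i) (fv f)
  end.

Definition fv_among (phi : form) (p : nat) : bool := all (fun i => i < p) (fv phi).

Definition sentence (phi : form) : bool := fv phi == [::].

(* partial assignments; unassigned variables are never used for formulas whose
   free variables are all assigned *)
Definition upd (G : graph) (e : nat -> option (vert G)) (i : nat) (v : vert G) :=
  fun j => if j == i then Some v else e j.

Fixpoint sat (G : graph) (e : nat -> option (vert G)) (phi : form) : bool :=
  match phi with
  | FEq i j => match e i, e j with Some a, Some b => a == b | _, _ => false end
  | FAdj i j => match e i, e j with Some a, Some b => adj a b | _, _ => false end
  | FNot f => ~~ sat e f
  | FAnd f g => sat e f && sat e g
  | FOr f g => sat e f || sat e g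
  | FExists i f => [exists v, sat (upd e i v) f]
  | FForall i f => [forall v, sat (upd e i v) f]
  end.

Definition models (G : graph) (theta : form) : bool := @sat G (fun _ => None) theta.

Definition env_of (G : graph) (p : nat) (t : {ffun 'I_p -> vert G}) : nat -> option (vert G) :=
  fun j => match insub j with Some k => Some (t k) | None => None end.

Definition stone (p : nat) (phi : form) (G : graph) : R :=
  Rdiv (INR #|[set t : {ffun 'I_p -> vert G} | sat (env_of t) phi]|) (INR (gorder G ^ p)).

Definition converges (u : nat -> R) : Prop := exists l, Un_cv u l.

Definition FO_convergent (Gs : nat -> graph) : Prop :=
  forall (p : nat) (phi : form), fv_among phi p ->
    converges (fun n => stone p phi (Gs n)).

Definition elementarily_convergent (Gs : nat -> graph) : Prop :=
  forall theta : form, sentence theta ->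
    (exists N, forall n, N <= n -> models (Gs n) theta) \/
    (exists N, forall n, N <= n -> ~~ models (Gs n) theta).

Definition ball (G : graph) (v : vert G) (r : nat) : {set vert G} :=
  iter r (fun S => S :|: [set y | [exists x in S, adj x y]]) [set v].

Definition rooted_iso_ball (G : graph) (v : vert G) (r : nat) (F : graph) (o : vert F) : bool :=
  [exists f : {ffun vert F -> vert G},
    [&& injectiveb f, ball v r == [set f x | x in vert F], f o == v &
        [forall x, forall y, adj x y == adj (f x) (f y)]]].

Definition ball_freq (r : nat) (F : graph) (o : vert F) (G : graph) : R :=
  Rdiv (INR #|[set v : vert G | rooted_iso_ball v r o]|) (INR (gorder G)).

Definition BS_convergent (d : nat) (Gs : nat -> graph) : Prop :=
  forall (r : nat) (F : graph) (o : vert F),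
    connectedb F -> maxdeg_le d F ->
    converges (fun n => ball_freq r o (Gs n)).

(* Main.v *)
(** In a graph of bounded degree there are finitely many isomorphism types of
    [r]-balls, and each of them, as well as "at least [k] vertices have this
    ball type", is first-order expressible; this gives the forward direction.

    For the converse, induction on a formula shows that, for [n] large, its truth
    at a tuple depends only on the isomorphism type of the [r]-ball around the
    tuple.  In the quantifier step a new vertex near the tuple is transported by
    the isomorphism; for a vertex far from the tuple one needs a far vertex of
    the same ball type, which exists because the numbers of vertices of each
    type, truncated at a fixed threshold, are eventually constant by elementary
    convergence.  All but a fraction [O(1/|G_n|)] of the [p]-tuples have entries
    pairwise far apart, and the ball of such a tuple is the disjoint union of the
    balls of its entries, so the Stone pairing is asymptotically a fixed
    polynomial in the ball frequencies. *)

Require Import Defs.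
From Stdlib Require Import Reals Lra Classical.
From mathcomp Require Import all_boot zify.

Set Implicit Arguments.
Unset Strict Implicit.
Unset Printing Implicit Defensive.

(* [all_boot] rebinds the key [R] to [ring_scope]. *)
Delimit Scope R_scope with Re.
Arguments ball : simpl never.

(** * Balls and local isomorphisms *)

Section Balls.
Variable G : graph.
Implicit Types u v w x : vert G.

Lemma ball_adj v k x u : x \in ball v k -> adj x u -> u \in ball v k.+1.
Proof.
move=> xv xu; rewrite /ball iterS !inE; apply/orP; right.
by apply/existsP; exists x; rewrite xv.
Qed.

Lemma ballSP v k u : u \in ball v k.+1 ->
  u \in ball v k \/ exists2 x, x \in ball v k & adj x u.
Proof.
rewrite {1}/ball iterS !inE => /orP[|/existsP[x /andP[xv xu]]]; first by left.
by right; exists x.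
Qed.

Lemma ball0 v : ball v 0 = [set v]. Proof. by []. Qed.

Lemma ball_subS v k : {subset ball v k <= ball v k.+1}.
Proof. by move=> u uv; rewrite /ball iterS inE uv. Qed.

Lemma ball_le v k l : k <= l -> {subset ball v k <= ball v l}.
Proof.
move=> /subnKC <-; elim: (l - k) => [|n IHn] u uv; first by rewrite addn0.
by rewrite addnS; apply: ball_subS; apply: IHn.
Qed.

Lemma ball_center v k : v \in ball v k.
Proof. by apply: (@ball_le v 0); rewrite ?ball0 ?set11. Qed.

Lemma ball_trans u v w k l :
  u \in ball v k -> w \in ball u l -> w \in ball v (k + l).
Proof.
move=> uv; elim: l w => [|l IHl] w; first by rewrite ball0 inE addn0 => /eqP ->.
rewrite addnS => /ballSP[/IHl|[x /IHl xv]]; first exact: ball_subS.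
exact: ball_adj.
Qed.

Lemma ball_sym u v k : u \in ball v k -> v \in ball u k.
Proof.
elim: k u => [|k IHk] u; first by rewrite !ball0 !inE eq_sym.
case/ballSP=> [/IHk|[x /IHk vx xu]]; first exact: ball_subS.
have xu1 : x \in ball u 1 by apply: (ball_adj (ball_center u 0)); rewrite adj_sym.
by rewrite -add1n; apply: ball_trans vx.
Qed.

(** Enlarging the radius by one adds at most [d] neighbours for each vertex already reached, hence a
    factor of at most [d.+1]. *)
Lemma card_ball d v k : maxdeg_le d G -> #|ball v k| <= d.+1 ^ k.
Proof.
move=> degG; elim: k => [|k IHk]; first by rewrite ball0 cards1.
have -> : ball v k.+1 = ball v k :|: \bigcup_(x in ball v k) [set y | adj x y].
  rewrite {1}/ball iterS -/(ball v k); congr (_ :|: _); apply/setP => y.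
  rewrite !inE; apply/existsP/bigcupP => [[x /andP[xv xy]]|[x xv]].
    by exists x; rewrite ?inE.
  by rewrite inE => xy; exists x; rewrite xv.
apply: leq_trans (leq_card_setU _ _) _.
rewrite expnSr mulnS; apply: leq_add => //.
apply: leq_trans (_ : #|ball v k| * d <= _); last by rewrite leq_mul2r IHk orbT.
rewrite -sum_nat_const.
elim/big_rec2: _ => [|x n A _ IH]; first by rewrite cards0.
by apply: leq_trans (leq_card_setU _ _) _; apply: leq_add.
Qed.

(** A common vertex would give a walk of length [2r] between the centres and an edge one of length
    [2r+1]; this is where the separation [2r+1] used throughout comes from. *)
Lemma balls_apart u v x y r :
  v \notin ball u (r.*2).+1 -> x \in ball u r -> y \in ball v r ->
  (x != y) && ~~ adj x y.
Proof.
move=> far xu /ball_sym vy; apply/andP; split; apply: contra far.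
  move=> /eqP xy; apply: (@ball_le u (r + r)); first by rewrite addnn.
  by apply: ball_trans xu _; rewrite xy.
move=> xy; rewrite -addnn -addSn; apply: ball_trans vy.
exact: ball_adj xu xy.
Qed.

End Balls.

(** * Maps that are isomorphisms on balls around several centres *)

Section LocalIso.
Variables G H : graph.

(** Preservation of equality in both directions contains injectivity. Two separate domains are
    allowed so that balls around different centres can be compared, non-edges included. *)
Definition pres_on (P Q : pred (vert G)) (f : vert G -> vert H) :=
  forall u w, P u -> Q w -> (f u == f w) = (u == w) /\ adj (f u) (f w) = adj u w.

Definition ball_iso r v v' (f : vert G -> vert H) :=
  [/\ f v = v',
      forall y, y \in ball v' r -> exists2 u, u \in ball v r & f u = y
    & pres_on (mem (ball v r)) (mem (ball v r)) f].

(** An isomorphism between the subgraphs induced by two unions of balls, matching the centres index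
    by index; [S] will be a set of variables, and [a], [b] assignments. *)
Definition local_iso (S : seq nat) r (a : nat -> vert G) (b : nat -> vert H) f :=
  (forall i, i \in S -> ball_iso r (a i) (b i) f) /\
  (forall i j, i \in S -> j \in S ->
     pres_on (mem (ball (a i) r)) (mem (ball (a j) r)) f).

(** A walk of length [l] from [w] stays inside the ball of radius [R], where [f] preserves edges, so
    its image is again a walk of length [l]. *)
Lemma ball_iso_into R v v' f w k l u : ball_iso R v v' f ->
  w \in ball v k -> k + l <= R -> u \in ball w l -> f u \in ball (f w) l.
Proof.
case=> _ _ pf wv; elim: l u => [|l IHl] u klR.
  by rewrite !ball0 !inE => /eqP ->.
have klR' : k + l <= R by lia.
case/ballSP=> [/(IHl _ klR')|[x xw xu]]; first exact: ball_subS.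
have xv : x \in ball v R by apply: (ball_le klR'); apply: ball_trans xw.
have uv : u \in ball v R.
  by apply: (ball_le klR); rewrite addnS; apply: ball_adj xu; apply: ball_trans xw.
by apply: (ball_adj (IHl _ klR' xw)); case: (pf x u xv uv) => _ ->.
Qed.

(** Walks of [H] are lifted one edge at a time: the next vertex still lies in the target ball, so it
    has a preimage, and reflection of adjacency makes this a neighbour of the previous one. *)
Lemma ball_iso_onto R v v' f w k l y : ball_iso R v v' f ->
  w \in ball v k -> k + l <= R -> y \in ball (f w) l ->
  exists2 u, u \in ball w l & f u = y.
Proof.
move=> isof wv; have [fv onto pf] := isof; elim: l y => [|l IHl] y klR.
  by rewrite ball0 inE => /eqP ->; exists w; rewrite ?ball_center.
have klR' : k + l <= R by lia.
case/ballSP=> [/(IHl _ klR')[u uw <-]|[x /(IHl _ klR')[u uw <-] uy]].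
  by exists u => //; apply: ball_subS.
have uv : u \in ball v (k + l) by apply: ball_trans uw.
have fuv : f u \in ball v' (k + l).
  rewrite -fv; apply: (ball_iso_into isof (ball_center v 0)) uv; lia.
have /onto[z zv fz] : y \in ball v' R.
  by apply: (ball_le klR); rewrite addnS; apply: ball_adj uy.
exists z => //; apply: (ball_adj uw).
by have [_ <-] := pf u z (ball_le klR' uv) zv; rewrite fz.
Qed.

Lemma ball_iso_sub R v v' f w k r : ball_iso R v v' f ->
  w \in ball v k -> k + r <= R -> ball_iso r w (f w) f.
Proof.
move=> isof wv krR; split=> // [y|x y /= xw yw].
  exact: (ball_iso_onto isof wv krR).
have [_ _ pf] := isof.
by apply: pf; apply: (ball_le krR); apply: ball_trans wv _.
Qed.

Lemma local_iso_le S r R a b f : r <= R ->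
  local_iso S R a b f -> local_iso S r a b f.
Proof.
move=> rR [isof pf]; split=> [i iS|i j iS jS u w /= ui wj].
  have [<- _ _] := isof i iS.
  exact: (ball_iso_sub (isof i iS) (ball_center _ 0)).
by apply: (pf i j) => //=; apply: (ball_le rR).
Qed.

Lemma local_iso_sub S S' r a a' b b' f : {subset S' <= S} ->
    {in S', a =1 a'} -> {in S', b =1 b'} ->
  local_iso S r a b f -> local_iso S' r a' b' f.
Proof.
move=> sub ea eb [isof pf]; split=> [i iS|i j iS jS].
  by rewrite -ea // -eb //; apply/isof/sub.
by rewrite -!ea //; apply: pf; apply: sub.
Qed.

(** The [r]-ball around [c] lies within distance [(2r+1) + r] of [a i], where [f] is already an
    isomorphism, so no new map is needed. *)
Lemma local_iso_near S r R x a b f i c :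
    local_iso S R a b f -> i \in S -> c \in ball (a i) (r.*2).+1 ->
    3 * r + 1 <= R -> a x = c -> b x = f c ->
  local_iso (x :: S) r a b f.
Proof.
move=> isof iS ci rR ax bx.
have krR : (r.*2).+1 + r <= R by lia.
have rR' : r <= R by lia.
have [isof_r _] := local_iso_le rR' isof.
have inball j : j \in x :: S ->
    exists2 k, k \in S & {subset ball (a j) r <= ball (a k) R}.
  rewrite inE => /orP[/eqP ->|jS]; last by exists j => //; apply: ball_le.
  exists i => // u; rewrite ax => uc; apply: (ball_le krR).
  exact: ball_trans uc.
have [isofR pf] := isof.
split=> [j|j k /inball[j' j'S jj'] /inball[k' k'S kk']].
  rewrite inE => /orP[/eqP ->|/isof_r //]; rewrite ax bx.
  exact: (ball_iso_sub (isofR i iS) ci).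
move=> u w /= uj wk; apply: (pf j' k') => //=; [exact: jj' | exact: kk'].
Qed.

(** Take [h] on the new ball and [f] elsewhere. In both graphs the new ball is disjoint from the old
    ones and joined to them by no edge, so the glued map preserves equality and adjacency. *)
Lemma local_iso_extend S r x a b f h :
    local_iso S r a b f -> ball_iso r (a x) (b x) h ->
    (forall i, i \in S -> a x \notin ball (a i) (r.*2).+1) ->
    (forall i, i \in S -> b x \notin ball (b i) (r.*2).+1) ->
  exists g, local_iso (x :: S) r a b g.
Proof.
move=> [isof pf] isoh fara farb; have [hx ontoh ph] := isoh.
pose g u := if u \in ball (a x) r then h u else f u.
have gx u : u \in ball (a x) r -> g u = h u by rewrite /g => ->.
have gS i u : i \in S -> u \in ball (a i) r -> g u = f u.
  move=> iS ui; rewrite /g ifN //; apply/negP => ux.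
  by have := balls_apart (fara i iS) ui ux; rewrite eqxx.
have fin i u : i \in S -> u \in ball (a i) r -> f u \in ball (b i) r.
  move=> iS ui; have [<- _ _] := isof i iS.
  exact: (ball_iso_into (isof i iS) (ball_center _ 0)) ui.
have hin u : u \in ball (a x) r -> h u \in ball (b x) r.
  by move=> ux; rewrite -hx; apply: (ball_iso_into isoh (ball_center _ 0)) ux.
have pgS i j : i \in S -> j \in S ->
    pres_on (mem (ball (a i) r)) (mem (ball (a j) r)) g.
  move=> iS jS u w /= ui wj; rewrite (gS i) // (gS j) //; exact: (pf i j).
have pgx : pres_on (mem (ball (a x) r)) (mem (ball (a x) r)) g.
  by move=> u w /= ux wx; rewrite !gx //; apply: ph.
exists g; split=> [i|i j].
  rewrite inE => /orP[/eqP ->|iS].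
    split=> // [|y /ontoh[u ux <-]]; first by rewrite gx ?ball_center.
    by exists u => //; apply: gx.
  have [fi onto _] := isof i iS; split=> [|y|]; last exact: pgS.
    by rewrite (gS i) ?ball_center.
  by case/onto=> u ui <-; exists u => //; apply: (gS i).
rewrite !inE => /orP[/eqP ->|iS] /orP[/eqP ->|jS] //; last exact: pgS.
  move=> u w /= ux wj; rewrite gx // (gS j) //.
  have /andP[/negPf n1 /negPf n2] := balls_apart (fara j jS) wj ux.
  have /andP[/negPf n3 /negPf n4] := balls_apart (farb j jS) (fin j w jS wj) (hin u ux).
  by rewrite eq_sym n3 [u == w]eq_sym n1 adj_sym n4 adj_sym n2.
move=> u w /= ui wx; rewrite (gS i) // gx //.
have /andP[/negPf n1 /negPf n2] := balls_apart (fara i iS) ui wx.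
have /andP[/negPf n3 /negPf n4] := balls_apart (farb i iS) (fin i u iS ui) (hin w wx).
by rewrite n3 n1 n4 n2.
Qed.

Lemma local_iso_scattered S r a b : uniq S -> inhabited (vert H) ->
    (forall i, i \in S -> exists h, ball_iso r (a i) (b i) h) ->
    (forall i j, i \in S -> j \in S -> i != j -> a i \notin ball (a j) (r.*2).+1) ->
    (forall i j, i \in S -> j \in S -> i != j -> b i \notin ball (b j) (r.*2).+1) ->
  exists f, local_iso S r a b f.
Proof.
move=> uS [y0]; elim: S uS => [|x S IHS] /= => [_ _ _ _|/andP[xS uS] isoS fara farb].
  (* Without centres any total map will do, but one has to exist. *)
  by exists (fun=> y0); split.
have [|i j iS jS|i j iS jS|f isof] := IHS uS.
- by move=> i iS; apply: isoS; rewrite inE iS orbT.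
- by apply: fara; rewrite inE ?iS ?jS orbT.
- by apply: farb; rewrite inE ?iS ?jS orbT.
have [h isoh] := isoS x (mem_head _ _).
have neq i : i \in S -> x != i by move=> iS; apply: contraNneq xS => ->.
apply: (local_iso_extend isof isoh) => i iS.
  by apply: fara; rewrite ?mem_head ?neq // inE iS orbT.
by apply: farb; rewrite ?mem_head ?neq // inE iS orbT.
Qed.

End LocalIso.

Lemma local_iso_sym G H S r a b (f : vert G -> vert H) :
  local_iso S r a b f -> exists g, local_iso S r b a g.
Proof.
move=> [isof pf].
pose P y u := has (fun i => u \in ball (a i) r) S && (f u == y).
(* The inverse on the images of the balls; elsewhere the default [a 0] is arbitrary. *)
pose g y := odflt (a 0) [pick u | P y u].
have gf i u : i \in S -> u \in ball (a i) r -> g (f u) = u.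
  move=> iS ui; rewrite /g; case: pickP => [w /andP[/hasP[j jS wj] /eqP e]|/(_ u)] /=.
    by apply/eqP; have [<- _] := pf j i jS iS w u wj ui; rewrite e.
  by rewrite /P eqxx andbT => /hasPn /(_ i iS); rewrite ui.
have pg i j : i \in S -> j \in S -> pres_on (mem (ball (b i) r)) (mem (ball (b j) r)) g.
  move=> iS jS y z /=; have [_ ontoi _] := isof i iS; have [_ ontoj _] := isof j jS.
  move=> /ontoi[u ui <-] /ontoj[w wj <-]; rewrite (gf i) // (gf j) //.
  by have [-> ->] := pf i j iS jS u w ui wj.
exists g; split=> // i iS; have [fi onto _] := isof i iS.
split; [by rewrite -fi (gf i) ?ball_center | | exact: pg].
move=> u ui; exists (f u); last exact: (gf i).
by rewrite -fi; apply: (ball_iso_into (isof i iS) (ball_center _ 0)) ui.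
Qed.

Lemma ball_iso_sym G H r v v' (f : vert G -> vert H) :
  ball_iso r v v' f -> exists g, ball_iso r v' v g.
Proof.
move=> isof; have [|g [/(_ 0 (mem_head _ _)) isog _]] :=
  @local_iso_sym G H [:: 0] r (fun=> v) (fun=> v') f.
  by split=> // i j _ _; case: isof.
by exists g.
Qed.

(** * Balls isomorphic to a given rooted graph *)

Section RootedIso.

Lemma rooted_isoP (G : graph) (v : vert G) r (F : graph) (o : vert F) :
  reflect (exists f : vert F -> vert G,
             [/\ injective f, (forall y, (y \in ball v r) <-> exists x, f x = y), f o = v
               & forall x y, adj x y = adj (f x) (f y)])
          (rooted_iso_ball v r o).
Proof.
apply: (iffP existsP) => [[f /and4P[/injectiveP injf /eqP Bf /eqP fo /forallP af]]|].
  exists f; split=> // [y|x y]; last by apply/eqP; move/forallP: (af x); apply.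
  rewrite Bf; split=> [/imsetP[x _ ->]|[x <-]]; [by exists x | exact: imset_f].
move=> [f [injf Bf fo af]]; exists [ffun x => f x]; apply/and4P; split.
- by apply/injectiveP => x y; rewrite !ffunE; apply: injf.
- apply/eqP/setP => y; apply/idP/imsetP => [/Bf[x <-]|[x _ ->]].
    by exists x; rewrite ?ffunE.
  by apply/Bf; exists x; rewrite ffunE.
- by rewrite ffunE fo.
- by apply/forallP => x; apply/forallP => y; rewrite !ffunE af.
Qed.

Variables (G H : graph) (v : vert G) (v' : vert H) (r : nat) (F : graph) (o : vert F).

Lemma rooted_iso_transfer h :
  ball_iso r v v' h -> rooted_iso_ball v r o -> rooted_iso_ball v' r o.
Proof.
move=> isoh /rooted_isoP[f [injf Bf fo af]]; have [hv onto ph] := isoh.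
have fB x : f x \in ball v r by apply/Bf; exists x.
apply/rooted_isoP; exists (h \o f); split=> /= [x y e|y||x y].
- by apply/injf/eqP; have [<- _] := ph _ _ (fB x) (fB y); apply/eqP.
- split=> [/onto[u /Bf[x <-] <-]|[x <-]]; first by exists x.
  by rewrite -hv; apply: (ball_iso_into isoh (ball_center _ 0)) (fB x).
- by rewrite fo.
by rewrite af; have [_ ->] := ph _ _ (fB x) (fB y).
Qed.

Lemma rooted_iso_ball_iso :
  rooted_iso_ball v r o -> rooted_iso_ball v' r o -> exists h, ball_iso r v v' h.
Proof.
move=> /rooted_isoP[f [injf Bf fo af]] /rooted_isoP[g [injg Bg go ag]].
(* On the ball this is [g] after the inverse of [f]; outside it the value [v'] is arbitrary. *)
pose h u := if [pick x | f x == u] is Some x then g x else v'.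
have hf x : h (f x) = g x.
  by rewrite /h; case: pickP => [y /eqP/injf -> //|/(_ x)]; rewrite eqxx.
exists h; split=> [|y /Bg[x <-]|u w /= /Bf[x <-] /Bf[y <-]].
- by rewrite -fo hf.
- by exists (f x); [apply/Bf; exists x | apply: hf].
by rewrite !hf -ag -af !inj_eq.
Qed.

(** BS-convergence speaks only of connected graphs of bounded degree, so this and the degree bound
    below are what allows applying it to an occurring ball type. Connectedness holds because a walk
    from the centre to a vertex of the ball stays in the ball. *)
Lemma rooted_iso_connected : rooted_iso_ball v r o -> connectedb F.
Proof.
move=> /rooted_isoP[f [injf Bf fo af]].
have conn k x : k <= r -> f x \in ball v k -> connect (@adj F) o x.
  elim: k x => [|k IHk] x kr.
    by rewrite ball0 inE -fo (inj_eq injf) => /eqP ->; apply: connect0.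
  case/ballSP=> [|[y yv]]; first exact/IHk/ltnW.
  have /Bf[x' fx'] : y \in ball v r by apply: ball_le yv; apply: ltnW.
  rewrite -fx' -af => /connect1; apply: connect_trans.
  by apply: IHk (ltnW kr) _; rewrite fx'.
have cr x : connect (@adj F) o x by apply: (conn r) => //; apply/Bf; exists x.
move=> x y; apply: connect_trans (cr y).
by rewrite (sym_connect_sym (@adj_sym F)).
Qed.

Lemma rooted_iso_maxdeg d : maxdeg_le d G -> rooted_iso_ball v r o -> maxdeg_le d F.
Proof.
move=> degG /rooted_isoP[f [injf _ _ af]] x.
apply: leq_trans (degG (f x)); rewrite -(card_imset _ injf).
by apply/subset_leq_card/subsetP => _ /imsetP[y + ->]; rewrite !inE af.
Qed.

End RootedIso.

(** * A finite type representing all small rooted graphs *)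

Section Codes.
Variable D : nat.

(** A size, an arbitrary Boolean matrix and a root. The matrix is made symmetric and loopless only
    when read as a graph, so that codes form a [finType] without side conditions. *)
Definition code := {m : 'I_D.+1 & ({ffun 'I_m * 'I_m -> bool} * 'I_m)%type}.

Definition code_adj (c : code) : rel 'I_(tag c) :=
  fun i j => (i != j) && ((tagged c).1 (i, j) || (tagged c).1 (j, i)).

Lemma code_adj_sym c : symmetric (@code_adj c).
Proof. by move=> i j; rewrite /code_adj eq_sym orbC. Qed.

Lemma code_adj_irr c : irreflexive (@code_adj c).
Proof. by move=> i; rewrite /code_adj eqxx. Qed.

Definition code_graph c := Graph (@code_adj_sym c) (@code_adj_irr c).

Definition code_root c : vert (code_graph c) := (tagged c).2.

Lemma rooted_iso_code (G : graph) (v : vert G) r : #|ball v r| <= D ->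
  exists c, rooted_iso_ball v r (code_root c).
Proof.
move=> leD; have vB := ball_center v r.
pose m : 'I_D.+1 := Ordinal (leD : #|ball v r| < D.+1).
pose M := [ffun ij : 'I_m * 'I_m =>
  adj (enum_val ij.1 : vert G) (enum_val ij.2)].
exists (Tagged (fun m : 'I_D.+1 => ({ffun 'I_m * 'I_m -> bool} * 'I_m)%type)
          (M, enum_rank_in vB v : 'I_m)).
apply/rooted_isoP; exists (fun i => enum_val (i : 'I_#|ball v r|)).
split=> [i j /enum_val_inj //|y||i j].
- split=> [yB|[i <-]]; last exact: enum_valP.
  by exists (enum_rank_in vB y); rewrite enum_rankK_in.
- by rewrite /code_root /= enum_rankK_in.
(* The matrix comes from a graph, so symmetrising it and removing loops changes nothing. *)
rewrite /= /code_adj /= !ffunE /= [adj (enum_val j) _]adj_sym orbb.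
by case: eqVneq => // <-; rewrite adj_irr.
Qed.

End Codes.

(** * Ball types are first-order expressible *)

Definition FTrue := FForall 0 (FEq 0 0).
Definition bigand := foldr FAnd FTrue.
Definition bigor := foldr FOr (FNot FTrue).
Definition iff_form f g := FOr (FAnd f g) (FAnd (FNot f) (FNot g)).
Definition lit (c : bool) f := if c then f else FNot f.
Definition exists_all (l : seq nat) f := foldr FExists f l.

Section Semantics.
Variable G : graph.
Implicit Types (e : nat -> option (vert G)) (f g : form).

Lemma sat_ext f e e' : {in fv f, e =1 e'} -> sat e f = sat e' f.
Proof.
elim: f e e' => [i j|i j|f IHf|f IHf g IHg|f IHf g IHg|i f IHf|i f IHf] e e' /= ee'.
- by rewrite !ee' ?inE ?eqxx ?orbT.
- by rewrite !ee' ?inE ?eqxx ?orbT.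
- by rewrite (IHf e e').
- by rewrite (IHf e e') ?(IHg e e') // => k kf; apply: ee'; rewrite mem_cat kf ?orbT.
- by rewrite (IHf e e') ?(IHg e e') // => k kf; apply: ee'; rewrite mem_cat kf ?orbT.
- apply: eq_existsb => v; apply: IHf => k kf; rewrite /upd.
  by case: eqVneq => // ki; apply: ee'; rewrite mem_filter /= ki.
apply: eq_forallb => v; apply: IHf => k kf; rewrite /upd.
by case: eqVneq => // ki; apply: ee'; rewrite mem_filter /= ki.
Qed.

Lemma sat_true e : sat e FTrue.
Proof. by apply/forallP => v; rewrite /= /upd /= eqxx. Qed.

Lemma sat_bigand e s : sat e (bigand s) = all (sat e) s.
Proof. by elim: s => [|f s /= ->]; rewrite ?(sat_true e). Qed.

Lemma sat_bigor e s : sat e (bigor s) = has (sat e) s.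
Proof.
by elim: s => [|f s /= -> //]; apply/negbTE; rewrite negbK; apply: sat_true.
Qed.

Lemma sat_iff e f g : sat e (iff_form f g) = (sat e f == sat e g).
Proof. by rewrite /=; case: (sat e f); case: (sat e g). Qed.

Lemma sat_lit e c f : sat e (lit c f) = (sat e f == c).
Proof. by case: c => /=; case: (sat e f). Qed.

Lemma sat_exists_all e l f : inhabited (vert G) ->
  sat e (exists_all l f) <->
  exists t : nat -> vert G, sat (fun j => if j \in l then Some (t j) else e j) f.
Proof.
case=> v0; elim: l e => [|x l IHl] e /=.
  by split=> [?|[]//]; exists (fun=> v0).
split=> [/existsP[v /IHl[t tf]]|[t tf]].
  (* If [x] occurs again in [l], the inner quantifier rebinds it and its witness prevails. *)
  exists (fun j => if j \in l then t j else v); move: tf.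
  rewrite (@sat_ext _ _ (fun j => if j \in x :: l then
    Some (if j \in l then t j else v) else e j)) // => j _.
  by rewrite /upd inE; case: eqVneq => //= _; case: ifP.
apply/existsP; exists (t x); apply/IHl; exists t; move: tf.
rewrite (@sat_ext _ _ (fun j => if j \in l then Some (t j) else upd e x (t x) j)) // => j _.
by rewrite /upd inE; case: eqVneq => [->|//]; case: ifP.
Qed.

End Semantics.

Lemma fv_exists_all l f : fv (exists_all l f) = [seq i <- fv f | i \notin l].
Proof.
elim: l => [|x l IHl] /=; first by rewrite filter_predT.
by rewrite IHl -filter_predI; apply: eq_filter => i /=; rewrite inE negb_or.
Qed.

(** Makes the free variables lie in [X] without computing those of [f]. When the truth of [f] is
    determined by the values on [X], the added quantifiers do not change it. *)
Definition close_over (X : seq nat) f := exists_all [seq i <- fv f | i \notin X] f.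

Lemma fv_close_over X f : {subset fv (close_over X f) <= X}.
Proof.
move=> i; rewrite fv_exists_all mem_filter => /andP[+ fi].
by rewrite mem_filter fi andbT negbK.
Qed.

Lemma sat_close_over (G : graph) X f (e : nat -> option (vert G)) c :
    inhabited (vert G) ->
    (forall e' : nat -> option (vert G), {in X, e =1 e'} -> sat e' f = c) ->
  sat e (close_over X f) = c.
Proof.
move=> inG fc; case: c fc => fc.
  have [v0] := inG; apply/sat_exists_all => //; exists (fun=> v0).
  by apply: fc => i iX; rewrite mem_filter iX.
apply/negP => /(sat_exists_all _ _ _ inG)[t].
by rewrite fc // => i iX; rewrite mem_filter iX.
Qed.

(** Says that [z] is within distance [r] of [x]. All variables from [b] on must be fresh, since
    nested levels bind [b], [b.+1] and so on. *)
Fixpoint dist_form r x z b :=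
  if r is r'.+1 then
    FOr (dist_form r' x z b) (FExists b (FAnd (dist_form r' x b b.+1) (FAdj b z)))
  else FEq x z.

Lemma sat_dist_form (G : graph) (e : nat -> option (vert G)) r x z b u v :
  x < b -> z < b -> e x = Some u -> e z = Some v ->
  sat e (dist_form r x z b) = (v \in ball u r).
Proof.
elim: r e z b v => [|r IHr] e z b v xb zb ex ez; rewrite [LHS]/=.
  by rewrite ex ez ball0 inE eq_sym.
rewrite (IHr _ _ _ v) // [in RHS]/ball iterS -/(ball u r) !inE; congr (_ || _).
apply: eq_existsb => w; rewrite /upd (IHr _ _ _ w) ?eqxx ?ifN ?ez ?ex //; lia.
Qed.

Section BallForm.
Variables (r : nat) (F : graph) (o : vert F).

(** The variables from [b] on name the images of the vertices of [F]. The three conjuncts say that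
    the root goes to [x], that the map is an induced embedding, and that its image is the ball. *)
Definition iso_form x b :=
  let y (u : vert F) := b + enum_rank u in
  let z := b + #|vert F| in
  exists_all (iota b #|vert F|)
    (bigand [:: FEq (y o) x;
       bigand [seq bigand [seq FAnd (lit (adj u w) (FAdj (y u) (y w)))
                                    (lit (u == w) (FEq (y u) (y w)))
                          | w <- enum (vert F)] | u <- enum (vert F)];
       FForall z (iff_form (dist_form r x z z.+1)
                           (bigor [seq FEq z (y u) | u <- enum (vert F)]))]).

Lemma sat_iso_form (G : graph) (e : nat -> option (vert G)) x b v :
  x < b -> e x = Some v -> sat e (iso_form x b) = rooted_iso_ball v r o.
Proof.
move=> xb ex; set m := #|vert F|.
pose y (u : vert F) : nat := b + enum_rank u.
have inG : inhabited (vert G) by exists.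
have yin u : y u \in iota b m.
  by rewrite mem_iota leq_addr ltn_add2l; apply: ltn_ord.
have xnin : x \notin iota b m by rewrite mem_iota; lia.
have satE (t : nat -> vert G) :
  let e' j := if j \in iota b m then Some (t j) else e j in
  sat e' (bigand [:: FEq (y o) x;
       bigand [seq bigand [seq FAnd (lit (adj u w) (FAdj (y u) (y w)))
                                    (lit (u == w) (FEq (y u) (y w)))
                          | w <- enum (vert F)] | u <- enum (vert F)];
       FForall (b + m) (iff_form (dist_form r x (b + m) (b + m).+1)
                           (bigor [seq FEq (b + m) (y u) | u <- enum (vert F)]))])
  <-> [/\ t (y o) = v,
         forall u w, (adj (t (y u)) (t (y w)) = adj u w) /\
                     (t (y u) == t (y w)) = (u == w)
       & forall z, (z \in ball v r) <-> exists u, t (y u) = z].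
  move=> e'; have e'y u : e' (y u) = Some (t (y u)) by rewrite /e' yin.
  have e'x : e' x = Some v by rewrite /e' (negPf xnin).
  have zE z : sat (upd e' (b + m) z) (iff_form (dist_form r x (b + m) (b + m).+1)
                (bigor [seq FEq (b + m) (y u) | u <- enum (vert F)]))
            <-> ((z \in ball v r) <-> exists u, t (y u) = z).
    rewrite sat_iff sat_bigor has_map.
    rewrite (@sat_dist_form _ _ _ _ _ _ v z) //; try lia; last 2 first.
    - by rewrite /upd ifN //; lia.
    - by rewrite /upd eqxx.
    have -> : has (preim (fun u => FEq (b + m) (y u)) (sat (upd e' (b + m) z)))
                (enum (vert F)) = [exists u, z == t (y u)].
      rewrite -(@eq_has _ (fun u => z == t (y u))) => [|u /=].
        by apply/hasP/existsP => [[u _ ?]|[u ?]]; exists u; rewrite ?mem_enum.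
      by rewrite /upd eqxx ifN ?e'y // neq_ltn ltn_add2l ltn_ord.
    split=> [/eqP ->|zB].
      by split=> [/existsP[u /eqP]|[u <-]]; [exists u | apply/existsP; exists u].
    apply/eqP; apply/idP/existsP => [/zB[u <-]|[u /eqP zu]]; first by exists u.
    by apply/zB; exists u.
  rewrite sat_bigand [all _ _]/= e'y e'x sat_bigand all_map andbT.
  split=> [/and3P[/eqP -> /allP H /forallP zB]|[-> H zB]].
    split=> // [u w|z]; last exact: (iffLR (zE z) (zB z)).
    have := H u; rewrite mem_enum /= sat_bigand all_map => /(_ isT)/allP/(_ w).
    by rewrite mem_enum /= !sat_lit /= !e'y => /(_ isT)/andP[/eqP -> /eqP ->].
  apply/and3P; split=> //; last by apply/forallP => z; apply/zE.
  apply/allP => u _; rewrite /= sat_bigand all_map; apply/allP => w _ /=.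
  by rewrite !sat_lit /= !e'y; have [-> ->] := H u w; rewrite !eqxx.
apply/idP/idP => [/(sat_exists_all _ _ _ inG)[t /satE[to tadj tB]]|].
  apply/rooted_isoP; exists (t \o y); split=> //= [u w /= /eqP|u w].
    by have [_ ->] := tadj u w => /eqP.
  by have [-> _] := tadj u w.
move=> /rooted_isoP[f [injf Bf fo af]]; apply/sat_exists_all => //.
pose t j := if [pick u | y u == j] is Some u then f u else v.
have ty u : t (y u) = f u.
  rewrite /t; case: pickP => [w /eqP|/(_ u)]; last by rewrite eqxx.
  by rewrite /y => /addnI/ord_inj/enum_rank_inj ->.
exists t; apply/satE; split=> [|u w|z]; first by rewrite ty.
  by rewrite !ty -af inj_eq.
by rewrite Bf; split=> -[u <-]; exists u; rewrite ty.
Qed.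

(** There are [k] distinct vertices of the given ball type. Variables below [k] name them; each
    [iso_form] binds only variables from [k] on, so none is captured. *)
Definition count_form k :=
  exists_all (iota 0 k)
    (bigand [seq FAnd (iso_form i k)
                      (bigand [seq lit (i == j) (FEq i j) | j <- iota 0 k])
            | i <- iota 0 k]).

Lemma sat_count_form (G : graph) (e : nat -> option (vert G)) k :
  inhabited (vert G) ->
  sat e (count_form k) = (k <= #|[set v : vert G | rooted_iso_ball v r o]|).
Proof.
move=> inG; set A := [set v | _].
have satE (t : nat -> vert G) :
  let e' j := if j \in iota 0 k then Some (t j) else e j in
  sat e' (bigand [seq FAnd (iso_form i k)
                      (bigand [seq lit (i == j) (FEq i j) | j <- iota 0 k])
            | i <- iota 0 k])
  <-> (forall i, i < k -> t i \in A /\ forall j, j < k -> (t i == t j) = (i == j)).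
  move=> e'; have e't i : i < k -> e' i = Some (t i) by rewrite /e' mem_iota /= => ->.
  have isoE i : i < k -> sat e' (iso_form i k) = (t i \in A).
    by move=> ik; rewrite (@sat_iso_form _ _ _ _ (t i)) ?inE // e't.
  rewrite sat_bigand all_map; split=> [/allP H i ik|H].
    have := H i; rewrite mem_iota /= isoE // => /(_ ik)/andP[-> ].
    rewrite sat_bigand all_map => /allP H'; split=> // j jk.
    by have := H' j; rewrite mem_iota /= sat_lit /= !e't // => /(_ jk)/eqP.
  apply/allP => i; rewrite mem_iota /= => ik; rewrite isoE //.
  have [-> Hi] := H i ik; rewrite sat_bigand all_map; apply/allP => j.
  by rewrite mem_iota /= => jk; rewrite sat_lit /= !e't // Hi.
apply/idP/idP => [/(sat_exists_all _ _ _ inG)[t /satE H]|kA].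
  rewrite cardE -[leqLHS](size_iota 0) -(size_map t); apply: uniq_leq_size.
    rewrite map_inj_in_uniq ?iota_uniq // => i j; rewrite !mem_iota /= => ik jk /eqP.
    by have [_ ->] := H i ik => // /eqP.
  by move=> _ /mapP[i + ->]; rewrite mem_iota mem_enum => /H[].
have [v0] := inG; apply/sat_exists_all => //; exists (nth v0 (enum A)).
rewrite cardE in kA; apply/satE => i ik; split.
  by rewrite -mem_enum mem_nth // (leq_trans ik).
by move=> j jk; rewrite nth_uniq ?enum_uniq // ?(leq_trans ik) ?(leq_trans jk).
Qed.

End BallForm.

(** * Locality of first-order formulas *)

Definition eventually (P : nat -> Prop) := exists N, forall n, N <= n -> P n.

Lemma eventually_forall (T : finType) (P : T -> nat -> Prop) :
  (forall x, eventually (P x)) -> eventually (fun n => forall x, P x n).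
Proof.
case/fin_all_exists=> N PN; exists (\max_x N x) => n le x; apply: PN.
by apply: leq_trans le; apply: leq_bigmax.
Qed.

Definition ball_count r (F : graph) (o : vert F) (G : graph) :=
  #|[set v : vert G | rooted_iso_ball v r o]|.

Definition assign (G : graph) (a : nat -> vert G) x c i := if i == x then c else a i.

(** * The back-and-forth step between two graphs *)

Section BackAndForth.
Variables (d r : nat) (G H : graph) (S : seq nat).
Let D := d.+1 ^ r.
(** Bounds the number of vertices within distance [2r+1] of the centres. *)
Let T := size S * d.+1 ^ (r.*2).+1.
Hypotheses (degG : maxdeg_le d G).
Hypothesis same_counts : forall (c : code D) k, k <= T ->
  (k < ball_count r (code_root c) G) = (k < ball_count r (code_root c) H).

(** A vertex [c] near some centre is moved by [f]. For a far [c], the near vertices of its ball type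
    are strictly fewer than all those of that type in [G]; comparing counts gives the same in [H],
    which leaves a far vertex of this type there. *)
Lemma back_and_forth x a b (f : vert G -> vert H) c :
    local_iso S (3 * r).+1 a b f -> x \notin S ->
  exists c' g, local_iso (x :: S) r (assign a x c) (assign b x c') g.
Proof.
move=> isof xS.
have eqS K (e : nat -> vert K) z : {in S, e =1 assign e x z}.
  by move=> i iS; rewrite /assign ifN //; apply: contraNneq xS => <-.
have isof' c' : local_iso S (3 * r).+1 (assign a x c) (assign b x c') f.
  by apply: local_iso_sub isof => //; apply: eqS.
have ax (K : graph) (e : nat -> vert K) z : assign e x z x = z by rewrite /assign eqxx.
case: (boolP (has (fun i => c \in ball (a i) (r.*2).+1) S)) => [/hasP[i iS ci]|/hasPn far].
  exists (f c), f; apply: (local_iso_near (isof' (f c)) iS) => //; rewrite ?ax //.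
    by rewrite -eqS.
  by rewrite addn1.
have [t ct] := rooted_iso_code (card_ball c r degG).
pose A := [set v : vert G | rooted_iso_ball v r (code_root t)].
pose A' := [set v : vert H | rooted_iso_ball v r (code_root t)].
pose near (K : graph) (e : nat -> vert K) :=
  [set v | has (fun i => v \in ball (e i) (r.*2).+1) S].
have leT : #|A :&: near G a| <= T.
  apply: leq_trans (subset_leq_card (subsetIr _ _)) _.
  have -> : near G a = \bigcup_(i <- S) ball (a i) (r.*2).+1.
    apply/setP => v; rewrite inE; elim: (S) => [|i s IHs] /=.
      by rewrite big_nil inE.
    by rewrite big_cons in_setU -IHs.
  rewrite /T; elim: (S) => [|i s IHs] /=; first by rewrite big_nil cards0.
  rewrite big_cons mulSn; apply: leq_trans (leq_card_setU _ _) _.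
  by apply: leq_add; first exact: card_ball.
have ltA : #|A :&: near G a| < #|A|.
  apply/proper_card/properP; split; first exact: subsetIl.
  exists c; first by rewrite inE.
  by rewrite !inE ct /=; apply/hasPn.
(* A near vertex of this type in [H] has a near preimage under [f]. Its [r]-ball lies within
   distance [3r+1] of a centre, so the preimage has the same type. *)
have leA' : #|A' :&: near H b| <= #|A :&: near G a|.
  apply: leq_trans (leq_imset_card f _); apply/subset_leq_card/subsetP => y.
  rewrite !inE => /andP[yt /hasP[i iS yi]]; have [isoi _] := isof.
  have [fi _ _] := isoi i iS; rewrite -fi in yi.
  have [|u ui fu] := ball_iso_onto (isoi i iS) (ball_center _ 0) _ yi; first by lia.
  apply/imsetP; exists u => //; rewrite !inE; apply/andP; split; last by apply/hasP; exists i.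
  have [|h isoh] := @ball_iso_sym _ _ r u y f.
    by rewrite -fu; apply: (ball_iso_sub (isoi i iS) ui); lia.
  exact: rooted_iso_transfer isoh yt.
have /properP[_ [c' c'A']] : A' :&: near H b \proper A'.
  rewrite properEcard subsetIl; apply: leq_ltn_trans leA' _.
  (* The hypothesis on counts is used with [k] the number of near vertices of this type in [G],
     which is at most [T]. *)
  by rewrite -[#|A'|]/(ball_count _ _ _) -same_counts.
rewrite inE c'A' /= inE => /hasPn farb; rewrite inE in c'A'.
have [h isoh] := rooted_iso_ball_iso ct c'A'.
have rR : r <= (3 * r).+1 by lia.
exists c'; apply: (local_iso_extend (local_iso_le rR (isof' c')) (h := h)).
- by rewrite !ax.
- by move=> i iS; rewrite ax -eqS ?far.
- by move=> i iS; rewrite ax -eqS ?farb.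
Qed.

End BackAndForth.

(** * Formulas along an elementarily convergent sequence *)

Section Locality.
Variables (d : nat) (Gs : nat -> graph).
Hypothesis deg : forall n, maxdeg_le d (Gs n).
Hypothesis large : forall M, exists N, forall n, N <= n -> M <= gorder (Gs n).
Hypothesis elem : elementarily_convergent Gs.

Lemma eventually_inhabited : eventually (fun n => inhabited (vert (Gs n))).
Proof.
have [N hN] := large 1; exists N => n /hN /card_gt0P[v _]; exact: inhabits v.
Qed.

Lemma ball_count_stable r (F : graph) (o : vert F) k :
  exists N, forall n m, N <= n -> N <= m ->
    (k <= ball_count r o (Gs n)) = (k <= ball_count r o (Gs m)).
Proof.
pose theta := close_over [::] (count_form r o k).
have theta_sentence : sentence theta.
  rewrite /sentence; case E: (fv theta) => [//|i s].
  by have := @fv_close_over [::] (count_form r o k) i; rewrite E mem_head => /(_ isT).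
have [N0 inh] := eventually_inhabited.
have E n : N0 <= n -> models (Gs n) theta = (k <= ball_count r o (Gs n)).
  move=> /inh inG; apply: sat_close_over => // e' _; exact: sat_count_form.
have [[N hN]|[N hN]] := elem theta_sentence; exists (maxn N N0) => n m;
  rewrite !geq_max => /andP[nN nN0] /andP[mN mN0]; rewrite -!E //.
  by rewrite !hN.
by rewrite !(negPf (hN _ _)).
Qed.

Lemma ball_counts_stable r D T : exists N, forall n m, N <= n -> N <= m ->
  forall (c : code D) k, k <= T ->
    (k < ball_count r (code_root c) (Gs n)) = (k < ball_count r (code_root c) (Gs m)).
Proof.
(* Agreement with all later graphs is a property of a single index, so one bound serves the finitely
   many codes and thresholds. *)
pose P (ck : code D * 'I_T.+1) n := forall m, n <= m ->
  (ck.2 < ball_count r (code_root ck.1) (Gs n)) = (ck.2 < ball_count r (code_root ck.1) (Gs m)).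
have [[c k]|N hN] := @eventually_forall _ P.
  have [N hN] := ball_count_stable r (code_root c) k.+1.
  by exists N => n nN m nm; apply: hN (leq_trans nN nm).
exists N => n m nN mN c k kT.
have := fun l lN => hN N (leqnn N) (c, Ordinal (kT : k < T.+1)) l lN.
by rewrite /= => h; rewrite -h // -h.
Qed.

(** Induction on the formula: atoms need radius [0], binary connectives take the larger radius, and
    a quantifier turns [r] into [3r+1]. *)
Lemma eventually_local phi (S : seq nat) : {subset fv phi <= S} ->
  exists N r, forall n m, N <= n -> N <= m -> forall a b (f : vert (Gs n) -> vert (Gs m)),
    local_iso S r a b f -> sat (Some \o a) phi = sat (Some \o b) phi.
Proof.
have quantifier x psi (S' : seq nat) : {subset [seq i <- fv psi | i != x] <= S'} ->
    (forall S : seq nat, {subset fv psi <= S} -> exists N r, forall n m, N <= n -> N <= m ->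
       forall a b (f : vert (Gs n) -> vert (Gs m)),
       local_iso S r a b f -> sat (Some \o a) psi = sat (Some \o b) psi) ->
    exists N r, forall n m, N <= n -> N <= m -> forall a b (f : vert (Gs n) -> vert (Gs m)),
      local_iso S' r a b f -> forall c, exists c',
        sat (upd (Some \o a) x c) psi = sat (upd (Some \o b) x c') psi.
  (* The old value of [x] is shadowed by the quantifier and may be unrelated to the new one, so its
     index is dropped before [x] is added afresh. *)
  move=> sub IH; pose S0 := [seq i <- S' | i != x].
  have [i ipsi|N [r hr]] := IH (x :: S0).
    rewrite inE; case: eqVneq => //= ix; rewrite mem_filter ix; apply: sub.
    by rewrite mem_filter ix.
  have [N' hN'] := ball_counts_stable r (d.+1 ^ r) (size S0 * d.+1 ^ (r.*2).+1).
  exists (maxn N N'), (3 * r).+1 => n m; rewrite !geq_max.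
  move=> /andP[nN nN'] /andP[mN mN'] a b f isof c.
  have isof0 : local_iso S0 (3 * r).+1 a b f.
    apply: local_iso_sub isof => // i; by rewrite mem_filter => /andP[].
  have [|c' [g isog]] := back_and_forth (@deg n) (hN' n m nN' mN') c isof0 (x := x).
    by rewrite mem_filter eqxx.
  exists c'; rewrite (@sat_ext _ _ _ (Some \o assign a x c)); last first.
    by move=> i _; rewrite /upd /assign /=; case: eqVneq.
  rewrite [RHS](@sat_ext _ _ _ (Some \o assign b x c')); last first.
    by move=> i _; rewrite /upd /assign /=; case: eqVneq.
  exact: hr isog.
have binary f g (S' : seq nat) : {subset fv f ++ fv g <= S'} -> {subset fv f <= S'} /\ {subset fv g <= S'}.
  by move=> sub; split=> i ifv; apply: sub; rewrite mem_cat ifv ?orbT.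
have atom n m S' r a b (f : vert (Gs n) -> vert (Gs m)) i j :
    local_iso S' r a b f -> i \in S' -> j \in S' ->
    (a i == a j) = (b i == b j) /\ adj (a i) (a j) = adj (b i) (b j).
  move=> [isof pf] iS jS; have [<- _ _] := isof i iS; have [<- _ _] := isof j jS.
  by have [-> ->] := pf i j iS jS _ _ (ball_center _ _) (ball_center _ _).
elim: phi S => [i j|i j|f IHf|f IHf g IHg|f IHf g IHg|x f IHf|x f IHf] S sub.
- exists 0, 0 => n m _ _ a b f isof /=.
  have [iS jS] : i \in S /\ j \in S by rewrite !sub //= !inE eqxx ?orbT.
  by have [-> _] := atom _ _ _ _ _ _ _ i j isof iS jS.
- exists 0, 0 => n m _ _ a b f isof /=.
  have [iS jS] : i \in S /\ j \in S by rewrite !sub //= !inE eqxx ?orbT.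
  by have [_ ->] := atom _ _ _ _ _ _ _ i j isof iS jS.
- have [N [r hr]] := IHf S sub; exists N, r => n m nN mN a b h isoh /=.
  by rewrite (hr n m nN mN a b h).
- have [subf subg] := binary f g S sub.
  have [N [r hr]] := IHf S subf; have [N' [r' hr']] := IHg S subg.
  exists (maxn N N'), (maxn r r') => n m; rewrite !geq_max.
  move=> /andP[nN nN'] /andP[mN mN'] a b h isoh /=.
  rewrite (hr n m nN mN a b h) ?(hr' n m nN' mN' a b h) //.
    by apply: local_iso_le isoh; rewrite leq_maxr.
  by apply: local_iso_le isoh; rewrite leq_maxl.
- have [subf subg] := binary f g S sub.
  have [N [r hr]] := IHf S subf; have [N' [r' hr']] := IHg S subg.
  exists (maxn N N'), (maxn r r') => n m; rewrite !geq_max.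
  move=> /andP[nN nN'] /andP[mN mN'] a b h isoh /=.
  rewrite (hr n m nN mN a b h) ?(hr' n m nN' mN' a b h) //.
    by apply: local_iso_le isoh; rewrite leq_maxr.
  by apply: local_iso_le isoh; rewrite leq_maxl.
- have [N [r hr]] := quantifier x f S sub IHf.
  (* The inverse map, with the two graphs exchanged, gives the other direction. *)
  exists N, r => n m nN mN a b h isoh; have [g isog] := local_iso_sym isoh.
  apply/existsP/existsP => -[c fc].
    by have [c' e] := hr n m nN mN a b h isoh c; exists c'; apply: etrans (esym e) fc.
  by have [c' e] := hr m n mN nN b a g isog c; exists c'; apply: etrans (esym e) fc.
- have [N [r hr]] := quantifier x f S sub IHf.
  exists N, r => n m nN mN a b h isoh; have [g isog] := local_iso_sym isoh.
  apply/forallP/forallP => fa c.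
    by have [c' e] := hr m n mN nN b a g isog c; apply: etrans e (fa c').
  by have [c' e] := hr n m nN mN a b h isoh c; apply: etrans e (fa c').
Qed.

End Locality.

(** * Frequencies of tuples *)

Lemma converges_eq u v :
  eventually (fun n => u n = v n) -> converges u -> converges v.
Proof.
move=> [N uv] [l ul]; exists l => eps /ul[M hM]; exists (maxn M N) => n /leP.
by rewrite geq_max => /andP[/leP nM nN]; rewrite -uv //; apply: hM.
Qed.

Lemma converges_const c : converges (fun=> c).
Proof.
by exists c => eps eps0; exists 0 => n _; rewrite /Rdist Rminus_diag Rabs_R0.
Qed.

Lemma converges_sum (I : finType) (P : pred I) (u : I -> nat -> R) :
  (forall i, converges (u i)) ->
  converges (fun n => \big[Rplus/0%Re]_(i | P i) u i n).
Proof.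
move=> cu; elim: (index_enum I) => [|i s [l hl]].
  by apply: converges_eq (converges_const 0); exists 0 => n _; rewrite big_nil.
have [l' hl'] := cu i; case Pi: (P i).
  apply: (@converges_eq (fun n => u i n + \big[Rplus/0]_(i <- s | P i) u i n)%Re).
    by exists 0 => n _; rewrite big_cons Pi.
  by exists (l' + l)%Re; apply: CV_plus.
by exists l => eps /hl[N hN]; exists N => n; rewrite big_cons Pi; apply: hN.
Qed.

Lemma converges_prod (I : finType) (u : I -> nat -> R) :
  (forall i, converges (u i)) -> converges (fun n => \big[Rmult/1%Re]_i u i n).
Proof.
move=> cu; elim: (index_enum I) => [|i s [l hl]].
  by apply: converges_eq (converges_const 1); exists 0 => n _; rewrite big_nil.
have [l' hl'] := cu i.
apply: (@converges_eq (fun n => u i n * \big[Rmult/1]_(i <- s) u i n)%Re).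
  by exists 0 => n _; rewrite big_cons.
by exists (l' * l)%Re; apply: CV_mult.
Qed.

Lemma converges_close u s : converges s ->
  (forall eps, (0 < eps)%Re -> eventually (fun n => (Rabs (u n - s n) < eps)%Re)) ->
  converges u.
Proof.
move=> [l hl] close; exists l => eps eps0.
have eps2 : (0 < eps / 2)%Re by lra.
have [N hN] := close _ eps2; have [M hM] := hl _ eps2.
exists (maxn N M) => n /leP; rewrite geq_max => /andP[/hN un /leP /hM].
rewrite /Rdist => sn; have := Rabs_triang (u n - s n) (s n - l).
by rewrite (_ : u n - s n + (s n - l) = u n - l)%Re; [lra | ring].
Qed.

Lemma INR_div_prod p (F : 'I_p -> nat) N :
  (INR (\prod_(i < p) F i) / INR (N ^ p) =
   \big[Rmult/1]_(i < p) (INR (F i) / INR N))%Re.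
Proof.
elim: p F => [|p IHp] F; first by rewrite !big_ord0 /=; field.
rewrite !big_ord_recl expnS -IHp !mult_INR /Rdiv Rinv_mult; ring.
Qed.

Lemma INR_div_sum (I : finType) (P : pred I) (F : I -> nat) x :
  (INR (\sum_(i | P i) F i) / x = \big[Rplus/0]_(i | P i) (INR (F i) / x))%Re.
Proof.
have morph : {morph (fun n => INR n / x)%Re : m n / m + n >-> (m + n)%Re}.
  by move=> m n; rewrite plus_INR /Rdiv; ring.
by rewrite (big_morph _ morph (id1 := 0%Re)) //= /Rdiv; ring.
Qed.

(** * Almost all tuples are scattered *)

Section Tuples.
Variables (d p : nat) (G : graph).
Hypothesis degG : maxdeg_le d G.
Implicit Types t : {ffun 'I_p -> vert G}.

Definition scattered k t :=
  [forall i, forall j, (i != j) ==> (t i \notin ball (t j) k)].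

(* The pair of a tuple with [t i] near [t j] and an arbitrary vertex is sent
   injectively to the tuple with entry [i] replaced by that vertex, and the old entry. *)
Lemma card_near_tuples k i j : i != j ->
  gorder G * #|[set t : {ffun 'I_p -> vert G} | t i \in ball (t j) k]| <= gorder G ^ p * d.+1 ^ k.
Proof.
move=> ij; rewrite mulnC /gorder -[#|vert G|]cardsT -cardsX.
pose rep (tv : {ffun 'I_p -> vert G} * vert G) :=
  ([ffun l => if l == i then tv.2 else tv.1 l], tv.1 i).
have injrep : injective rep.
  move=> [t v] [t' v'] [/ffunP e ti]; congr pair; last first.
    by have := e i; rewrite !ffunE eqxx.
  apply/ffunP => l; have := e l; rewrite !ffunE.
  by case: eqVneq => [->|].
rewrite -(card_imset _ injrep).
apply: leq_trans (_ : #|[set tv : {ffun 'I_p -> vert G} * vert G |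
                         tv.2 \in ball (tv.1 j) k]| <= _).
  apply/subset_leq_card/subsetP => _ /imsetP[[t v] + ->].
  by rewrite !inE /= andbT ffunE eq_sym (negPf ij).
rewrite -sum1dep_card -(pair_big_dep xpredT (fun t v => v \in ball (t j) k) (fun _ _ => 1)) /=.
apply: leq_trans (_ : \sum_(t : {ffun 'I_p -> vert G}) d.+1 ^ k <= _).
  by apply: leq_sum => t _; rewrite sum1_card; apply: card_ball.
by rewrite sum_nat_const card_ffun card_ord cardsT.
Qed.

(** A union bound over the pairs of indices whose entries are close. *)
Lemma card_non_scattered k :
  gorder G * #|[set t : {ffun 'I_p -> vert G} | ~~ scattered k t]| <= p * p * (gorder G ^ p * d.+1 ^ k).
Proof.
pose X (ij : 'I_p * 'I_p) := [set t : {ffun 'I_p -> vert G} | t ij.1 \in ball (t ij.2) k].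
apply: leq_trans (_ : gorder G * #|\bigcup_(ij | ij.1 != ij.2) X ij| <= _).
  rewrite leq_mul2l; apply/orP; right; apply/subset_leq_card/subsetP => t.
  rewrite inE => /forallPn[i /forallPn[j]]; rewrite negb_imply negbK => /andP[ij tij].
  by apply/bigcupP; exists (i, j); rewrite // inE.
apply: leq_trans (_ : \sum_(ij | ij.1 != ij.2) gorder G * #|X ij| <= _).
  rewrite -big_distrr leq_mul2l; apply/orP; right.
  elim/big_rec2: _ => [|ij n A _ IH]; first by rewrite cards0.
  by apply: leq_trans (leq_card_setU _ _) _; apply: leq_add.
apply: leq_trans (_ : \sum_(ij : 'I_p * 'I_p) gorder G ^ p * d.+1 ^ k <= _).
  rewrite big_mkcond; apply: leq_sum => ij _.
  by case: ifP => // /card_near_tuples; apply.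
by rewrite sum_nat_const card_prod card_ord.
Qed.

End Tuples.

(** * Ball types of vertices and of tuples *)

Section BallType.
Variables D r : nat.

(* [pick] depends only on the set of matching codes, and the sets of codes
   matching two balls are equal or disjoint. *)
Definition ball_type (G : graph) (v : vert G) : option (code D) :=
  [pick c | rooted_iso_ball v r (code_root c)].

Lemma ball_type_matches (G : graph) (v : vert G) c :
  ball_type v = Some c -> rooted_iso_ball v r (code_root c).
Proof. by rewrite /ball_type; case: pickP => // c' vc' [<-]. Qed.

Lemma ball_type_some (G : graph) (v : vert G) d :
  maxdeg_le d G -> D = d.+1 ^ r -> ball_type v != None.
Proof.
move=> degG eD; rewrite /ball_type; case: pickP => // none.
have [|c vc] := @rooted_iso_code D G v r; first by rewrite eD card_ball.
by rewrite none in vc.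
Qed.

(** Identifies the set of vertices of an occurring type with the set counted by [ball_freq]:
    vertices matching a common code have isomorphic balls, hence match the same codes. *)
Lemma ball_type_eq (G H : graph) (v : vert G) (w : vert H) c :
  ball_type v = Some c -> (ball_type w == Some c) = rooted_iso_ball w r (code_root c).
Proof.
move=> vc; have vm := ball_type_matches vc.
apply/eqP/idP => [/ball_type_matches //|wm]; rewrite -vc /ball_type.
apply: eq_pick => c'; apply/idP/idP => m.
  by have [h isoh] := rooted_iso_ball_iso wm vm; apply: rooted_iso_transfer isoh m.
by have [h isoh] := rooted_iso_ball_iso vm wm; apply: rooted_iso_transfer isoh m.
Qed.

Definition tuple_type p (G : graph) (t : {ffun 'I_p -> vert G}) :=
  [ffun i => ball_type (t i)].

Lemma card_tuple_type p (G : graph) (w : {ffun 'I_p -> option (code D)}) :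
  #|[set t : {ffun 'I_p -> vert G} | tuple_type t == w]| =
  \prod_(i < p) #|[set v : vert G | ball_type v == w i]|.
Proof.
have -> : #|[set t : {ffun 'I_p -> vert G} | tuple_type t == w]| =
    #|family (fun i => mem [set v : vert G | ball_type v == w i])|.
  apply: eq_card => t; rewrite inE; apply/eqP/familyP => [<- i|tw].
    by rewrite !inE ffunE.
  by apply/ffunP => i; have := tw i; rewrite !inE ffunE => /eqP.
by rewrite card_family foldrE big_map big_enum.
Qed.

End BallType.

(** * The two implications *)

Section Sequences.
Variables (d : nat) (Gs : nat -> graph).
Hypothesis deg : forall n, maxdeg_le d (Gs n).
Hypothesis large : forall M, exists N, forall n, N <= n -> M <= gorder (Gs n).

(** For [p = 0] there is exactly one tuple, so the Stone pairing is [0] or [1], and a convergent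
    sequence of such values is eventually constant. *)
Lemma FO_elementarily_convergent : FO_convergent Gs -> elementarily_convergent Gs.
Proof.
move=> FO theta /eqP th.
have [|l hl] := FO 0 theta; first by rewrite /fv_among th.
have stoneE n : stone 0 theta (Gs n) = if models (Gs n) theta then 1%Re else 0%Re.
  have satE (t : {ffun 'I_0 -> vert (Gs n)}) : sat (env_of t) theta = models (Gs n) theta.
    by apply: sat_ext => i; rewrite th.
  rewrite /stone; under eq_finset => t do rewrite satE.
  case: (models _ _); last by rewrite cards0 /Rdiv Rmult_0_l.
  by rewrite cardsT card_ffun card_ord /=; field.
have half : (0 < 1 / 2)%Re by lra.
have [N hN] := hl _ half.
have same n : N <= n -> models (Gs n) theta = models (Gs N) theta.
  move=> /leP nN; have := hN n nN; have := hN N (le_n N); rewrite /Rdist !stoneE.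
  by do 2!case: (models _ _) => //; split_Rabs; lra.
case E: (models (Gs N) theta); [left | right]; exists N => n /same ->; by rewrite E.
Qed.

Lemma FO_BS_convergent : FO_convergent Gs -> BS_convergent d Gs.
Proof.
move=> FO r F o _ _; pose phi := close_over [:: 0] (iso_form r o 0 1).
have fv_phi : fv_among phi 1.
  by apply/allP => i /fv_close_over; rewrite inE => /eqP ->.
apply: converges_eq (FO 1 phi fv_phi).
have [N inh] := eventually_inhabited large; exists N => n /inh inG.
rewrite /stone /ball_freq expn1; congr (INR _ / _)%Re.
have satE (t : {ffun 'I_1 -> vert (Gs n)}) :
    sat (env_of t) phi = rooted_iso_ball (t ord0) r o.
  apply: sat_close_over => // e' /(_ 0 (mem_head _ _)) e0.
  apply: sat_iso_form => //; rewrite -e0 /env_of; case: insubP => // k _ k0.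
  by congr (Some (t _)); apply: val_inj.
have injt : injective (fun v : vert (Gs n) => [ffun _ : 'I_1 => v]).
  by move=> v w /ffunP/(_ ord0); rewrite !ffunE.
rewrite -(card_imset _ injt); apply: eq_card => t; rewrite inE satE.
apply/idP/imsetP => [tr|[v + ->]]; last by rewrite inE ffunE.
by exists (t ord0); rewrite ?inE //; apply/ffunP => i; rewrite ffunE ord1.
Qed.

Lemma ball_type_freq_converges r (o : option (code (d.+1 ^ r))) : BS_convergent d Gs ->
  converges (fun n =>
    INR #|[set v : vert (Gs n) | ball_type _ r v == o]| / INR (gorder (Gs n)))%Re.
Proof.
move=> BS.
(* A type occurring nowhere has frequency [0]. An occurrence shows that its graph is connected and
   of degree at most [d], so BS-convergence applies. *)
case: (classic (exists n (v : vert (Gs n)), ball_type _ r v = o)) => [[n [v]]|none]; last first.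
  apply: converges_eq (converges_const 0); exists 0 => n _.
  have -> : [set v : vert (Gs n) | ball_type _ r v == o] = set0.
    by apply/setP => v; rewrite !inE; apply/eqP => vo; apply: none; exists n, v.
  by rewrite cards0 /Rdiv Rmult_0_l.
case: o => [c vc|vN]; last first.
  by have := @ball_type_some (d.+1 ^ r) r _ v d (@deg n) erefl; rewrite vN.
have vm := ball_type_matches vc.
apply: converges_eq (BS r _ _ (rooted_iso_connected vm) (rooted_iso_maxdeg (@deg n) vm)).
exists 0 => m _; rewrite /ball_freq.
by congr (INR _ / _)%Re; apply: eq_card => w; rewrite !inE (ball_type_eq w vc).
Qed.

(** The map [beta] must not depend on [n]: locality compares tuples of different late graphs, so
    equal types force equal truth values across the sequence. *)
Lemma scattered_sat_by_type p phi : elementarily_convergent Gs -> fv_among phi p ->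
  exists r N (beta : {ffun 'I_p -> option (code (d.+1 ^ r))} -> bool), forall n,
    N <= n -> forall t : {ffun 'I_p -> vert (Gs n)}, scattered (r.*2).+1 t ->
    sat (env_of t) phi = beta (tuple_type (d.+1 ^ r) r t).
Proof.
move=> elem /allP fvp.
have [|N [r local]] := @eventually_local d Gs deg large elem phi (iota 0 p).
  by move=> i /fvp; rewrite mem_iota.
have [N' inh] := eventually_inhabited large.
have same n m (t : {ffun 'I_p -> vert (Gs n)}) (t' : {ffun 'I_p -> vert (Gs m)}) :
    maxn N N' <= n -> maxn N N' <= m ->
    scattered (r.*2).+1 t -> scattered (r.*2).+1 t' ->
    tuple_type (d.+1 ^ r) r t = tuple_type (d.+1 ^ r) r t' ->
    sat (env_of t) phi = sat (env_of t') phi.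
  rewrite !geq_max => /andP[nN /inh[v]] /andP[mN /inh[v']] st st' tt'.
  (* Locality concerns total assignments, so a tuple is extended by an arbitrary vertex. *)
  pose total k (s : {ffun 'I_p -> vert (Gs k)}) (w : vert (Gs k)) i :=
    if insub i is Some j then s j else w.
  have totalE k (s : {ffun 'I_p -> vert (Gs k)}) w :
      sat (env_of s) phi = sat (Some \o total k s w) phi.
    apply: sat_ext => i /fvp ip; rewrite /env_of /total /=.
    by case: insubP => //; rewrite ip.
  have tot k (s : {ffun 'I_p -> vert (Gs k)}) w i (ip : i < p) :
      total k s w i = s (Ordinal ip) by rewrite /total insubT.
  have far k (s : {ffun 'I_p -> vert (Gs k)}) w : scattered (r.*2).+1 s ->
      forall i j, i \in iota 0 p -> j \in iota 0 p -> i != j ->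
      total k s w i \notin ball (total k s w j) (r.*2).+1.
    move=> /forallP ss i j; rewrite !mem_iota /= => ip jp ij; rewrite !tot.
    by have /forallP/(_ (Ordinal jp))/implyP := ss (Ordinal ip); apply.
  rewrite (totalE n t v) (totalE m t' v').
  have [|||f isof] := @local_iso_scattered _ _ (iota 0 p) r (total n t v)
    (total m t' v') (iota_uniq _ _) (inhabits v').
  - move=> i; rewrite mem_iota /= => ip; rewrite !tot.
    have := congr1 (fun w : {ffun _} => w (Ordinal ip)) tt'; rewrite !ffunE.
    have := ball_type_some (t (Ordinal ip)) (@deg n) (erefl (d.+1 ^ r)).
    case tc: (ball_type _ _) => [c|//] _ /esym t'c.
    exact: rooted_iso_ball_iso (ball_type_matches tc) (ball_type_matches t'c).
  - exact: far.
  - exact: far.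
  exact: local isof.
have [w|beta hbeta] := @fin_all_exists _ _ (fun (w : {ffun 'I_p -> option (code (d.+1 ^ r))}) b =>
    forall n (t : {ffun 'I_p -> vert (Gs n)}), maxn N N' <= n -> scattered (r.*2).+1 t ->
    tuple_type (d.+1 ^ r) r t = w -> sat (env_of t) phi = b); last first.
  by exists r, (maxn N N'), beta => n nN t st; apply: hbeta.
(* If some late scattered tuple has type [w], its truth value is taken; otherwise any value
   works. *)
case: (classic (exists n (t : {ffun 'I_p -> vert (Gs n)}), [/\ maxn N N' <= n,
    scattered (r.*2).+1 t & tuple_type (d.+1 ^ r) r t = w])) => [[m [t' [mN st' <-]]]|none].
  by exists (sat (env_of t') phi) => n t nN st tt'; apply: same.
by exists true => n t nN st tw; case: none; exists n, t.
Qed.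

Lemma BS_elementary_FO_convergent :
  BS_convergent d Gs -> elementarily_convergent Gs -> FO_convergent Gs.
Proof.
move=> BS elem p phi fvp.
have [r [N [beta hbeta]]] := scattered_sat_by_type elem fvp.
pose B n := [set t : {ffun 'I_p -> vert (Gs n)} | beta (tuple_type (d.+1 ^ r) r t)].
(* The proportion of tuples whose type is accepted by [beta]; summing over accepted types gives a
   polynomial in type frequencies. *)
pose s n := (INR #|B n| / INR (gorder (Gs n) ^ p))%Re.
apply: (@converges_close _ s).
  apply: (@converges_eq (fun n => \big[Rplus/0]_(w | beta w) \big[Rmult/1]_(i < p)
    (INR #|[set v : vert (Gs n) | ball_type _ r v == w i]| / INR (gorder (Gs n))))%Re).
    exists 0 => n _; under eq_bigr => w _ do rewrite -INR_div_prod -card_tuple_type.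
    rewrite -INR_div_sum /s; congr (INR _ / _)%Re.
    rewrite -sum1_card (partition_big (@tuple_type (d.+1 ^ r) r p (Gs n)) beta) /=; last first.
      by move=> t; rewrite inE.
    apply: eq_bigr => w bw; rewrite -sum1_card; apply: eq_bigl => t.
    by rewrite !inE; case: eqP => [->|]; rewrite ?bw ?andbF.
  apply: converges_sum => w; apply: converges_prod => i.
  exact: ball_type_freq_converges.
(* Non-scattered tuples form a fraction of at most [C] over the order of the graph, so an order
   above [C / eps] suffices. *)
move=> eps eps0; pose C := p * p * d.+1 ^ (r.*2).+1.
have [M hM] := INR_unbounded (INR C / eps).
have [N' hN'] := large M.+1; exists (maxn N N') => n; rewrite geq_max.
move=> /andP[nN /hN' Mn].
pose A := [set t : {ffun 'I_p -> vert (Gs n)} | sat (env_of t) phi].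
pose NS := [set t : {ffun 'I_p -> vert (Gs n)} | ~~ scattered (r.*2).+1 t].
(* The two sets of tuples differ only in non-scattered tuples, so their sizes differ by at most
   [#|NS|]. *)
have AB t : t \notin NS -> (t \in A) = (t \in B n).
  by rewrite !inE negbK => /(hbeta n nN) ->.
have leAB : #|A| <= #|B n| + #|NS|.
  apply: leq_trans (leq_card_setU _ _); apply/subset_leq_card/subsetP => t tA.
  by rewrite in_setU; case: (boolP (t \in NS)) => [|/AB <-]; rewrite ?orbT ?tA.
have leBA : #|B n| <= #|A| + #|NS|.
  apply: leq_trans (leq_card_setU _ _); apply/subset_leq_card/subsetP => t tB.
  by rewrite in_setU; case: (boolP (t \in NS)) => [|/AB ->]; rewrite ?orbT ?tB.
have := @card_non_scattered d p (Gs n) (@deg n) (r.*2).+1; rewrite -/NS.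
rewrite [_ ^ p * _]mulnC mulnA -/C; move: (C) hM => {}C hM leNS.
have leR a b : a <= b -> (INR a <= INR b)%Re by move=> /leP; apply: le_INR.
move: leAB leBA leNS => /leR + /leR + /leR; rewrite /s /stone -/A.
set N0 := gorder (Gs n) in Mn *; set Np := N0 ^ p; rewrite !plus_INR !mult_INR.
have N0pos : (INR M < INR N0)%Re by apply: lt_INR; apply/ltP.
have Nppos : (0 < INR Np)%Re.
  by apply: (lt_INR 0); apply/ltP; rewrite expn_gt0 (leq_trans _ Mn).
have Mpos := pos_INR M.
move: (INR #|A|) (INR #|B n|) (INR #|NS|) (INR C) hM => a b c k hM h1 h2 h3.
have h4 : (k < eps * INR N0)%Re.
  have : (k / eps * eps < INR N0 * eps)%Re by apply: Rmult_lt_compat_r; lra.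
  by rewrite (_ : k / eps * eps = k)%Re; [lra | field; lra].
have h5 : (c < eps * INR Np)%Re.
  apply: (Rmult_lt_reg_l (INR N0)); first by lra.
  by have := Rmult_lt_compat_r _ _ _ Nppos h4; lra.
have eNp : ((a / INR Np - b / INR Np) * INR Np = a - b)%Re by field; lra.
by apply: Rabs_def1; apply: (Rmult_lt_reg_r (INR Np)) => //; rewrite eNp; lra.
Qed.

End Sequences.

Theorem theorem5p18 (d : nat) (Gs : nat -> graph) :
  (forall n, maxdeg_le d (Gs n)) ->
  (forall M : nat, exists N, forall n, N <= n -> M <= gorder (Gs n)) ->
  FO_convergent Gs <-> (BS_convergent d Gs /\ elementarily_convergent Gs).
Proof.
move=> deg large; split=> [FO|[]]; last exact: BS_elementary_FO_convergent.
by split; [apply: FO_BS_convergent | apply: FO_elementarily_convergent].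
Qed.
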